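(* Let $(\mathcal{M},\Psi,A)$ be a quantum graph. Let $P_A, P_A' : B(L^2(\mathcal{M},\Psi)) \to B(L^2(\mathcal{M},\Psi))$ be given by $P_A(X)=\delta^{-2}\, A\cdot_S X$ and $P_A'(X)=\delta^{-2}\, X\cdot_S A$. Then $P_A$ is self-adjoint with respect to the left scalar product $\langle\cdot,\cdot\rangle_L$, i.e. $P_A^{\dagger_L}=P_A$, and $P_A'$ is self-adjoint with respect to the right scalar product $\langle\cdot,\cdot\rangle_R$, i.e. $(P_A')^{\dagger_R}=P_A'$.
   Context: All $C^*$-algebras are finite-dimensional and unital. For a $C^*$-algebra $\mathcal{M}$ and a faithful positive functional $\Psi$ on $\mathcal{M}$, $L^2(\mathcal{M},\Psi)$ is the vector space $\mathcal{M}$ with inner product $\langle a,b\rangle_\Psi=\Psi(a^*b)$. The multiplication $m:L^2(\mathcal{M},\Psi)\otimes L^2(\mathcal{M},\Psi)\to L^2(\mathcal{M},\Psi)$, $m(a\otimes b)=ab$, has Hilbert space adjoint $m^\dagger$. $(\mathcal{M},\Psi)$ is a quantum system with parameter $\delta>0$ if $mm^\dagger=\delta^2\,\mathrm{id}$. The Schur product on $B(L^2(\mathcal{M},\Psi))$ is $M_1\cdot_S M_2=m(M_1\otimes M_2)m^\dagger$. Modular group: writing $\Psi(a)=\mathrm{Tr}(\rho a)$ with $\rho\in\mathcal{M}$ positive and invertible and $\mathrm{Tr}$ a faithful trace on $\mathcal{M}$, set $\sigma_z(a)=\rho^{iz}a\rho^{-iz}$ for $z\in\mathbb{C}$; it satisfies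 $\Psi(ab)=\Psi(b\,\sigma_{-i}(a))$. A quantum graph is a triple $(\mathcal{M},\Psi,A)$ where $(\mathcal{M},\Psi)$ is a quantum system with parameter $\delta$ and $A\in B(L^2(\mathcal{M},\Psi))$ satisfies $m(A\otimes A)m^\dagger=\delta^2A$, $A(x)^*=A(x^* )$ and $A^\dagger(x)^*=A^\dagger(x^* )$ for all $x$, where $\dagger$ is the adjoint on $L^2(\mathcal{M},\Psi)$. The left and right scalar products on $B(L^2(\mathcal{M},\Psi))$ are $\langle X,Y\rangle_L=\mathrm{Tr}((\sigma_i\circ X)^\dagger Y)$ and $\langle X,Y\rangle_R=\mathrm{Tr}((X\circ\sigma_{-i})^\dagger Y)$, with $\mathrm{Tr}$ here the operator trace on $B(L^2(\mathcal{M},\Psi))$; $\dagger_L$ and $\dagger_R$ denote the corresponding adjoints. *)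

(* Defs.v *)
From HB Require Import structures.
From mathcomp Require Import all_boot all_order all_algebra all_field.
From mathcomp Require Import complex ring lra.
From mathcomp Require Import boolp classical_sets reals sequences exp trigo.

Set Implicit Arguments.
Unset Strict Implicit.
Unset Printing Implicit Defensive.

Import Order.TTheory GRing.Theory Num.Theory.
Local Open Scope ring_scope.
Local Open Scope complex_scope.

(* The complex field is R[i] for an arbitrary realType R. Inner products are
   antilinear in the first argument and linear in the second. *)

(* Completeness is automatic in finite dimension, and nonnegativity of the norm
   follows from the axioms. falgType excludes the zero algebra. *)
HB.mixin Record isCStar (R : realType) M of Falgebra R[i] M := {
  star : M -> M;
  cnorm : M -> R;
  starD : forall x y, star (x + y) = star x + star y;
  starZ : forall (c : R[i]) x, star (c *: x) = c^* *: star x;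
  starM : forall x y, star (x * y) = star y * star x;
  starK : forall x, star (star x) = x;
  cnorm0_eq0 : forall x, cnorm x = 0 -> x = 0;
  cnormD : forall x y, cnorm (x + y) <= cnorm x + cnorm y;
  cnormZ : forall (c : R[i]) x, (cnorm (c *: x))%:C = `|c| * (cnorm x)%:C;
  cnormM : forall x y, cnorm (x * y) <= cnorm x * cnorm y;
  cnorm_star : forall x, cnorm (star x * x) = cnorm x ^+ 2
}.

#[short(type="cstarAlgType")]
HB.structure Definition CStarAlgebra (R : realType) :=
  { M of isCStar R M & Falgebra R[i] M }.

Definition bvec (K : fieldType) (V : vectType K) (i : 'I_(\dim {:V})) : V :=
  (vbasis {:V})`_i.

Section Adjoint.
Variable R : realType.
Local Notation C := R[i].

Record inner_product (U : vectType C) (ip : U -> U -> C) : Prop := {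
  ip_linear : forall u, scalar (ip u);
  ip_conj : forall u v, ip v u = (ip u v)^*;
  ip_pos : forall u, u != 0 -> 0 < ip u u
}.

(* The junk value 0 is returned only if no adjoint exists, which cannot happen
   for inner products by [adjointP] below. *)
Definition adjoint (V W : vectType C) (ipV : V -> V -> C) (ipW : W -> W -> C)
    (f : 'Hom(V, W)) : 'Hom(W, V) :=
  xget 0 [set g : 'Hom(W, V) | forall v w, ipW (f v) w = ipV v (g w)].

Lemma ip_sumr (U : vectType C) (ip : U -> U -> C) (I : finType) u (c : I -> C)
    (x : I -> U) : inner_product ip ->
  ip u (\sum_i c i *: x i) = \sum_i c i * ip u (x i).
Proof.
move=> H; pose l : {linear U -> C^o} := HB.pack (ip u)
  (GRing.isLinear.Build C U C^o *%R (ip u) (ip_linear H u)).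
rewrite -[ip u]/(l : U -> C) linear_sum; apply: eq_bigr => i _.
exact: linearZ.
Qed.

Lemma ip_suml (U : vectType C) (ip : U -> U -> C) (I : finType) u (c : I -> C)
    (x : I -> U) : inner_product ip ->
  ip (\sum_i c i *: x i) u = \sum_i (c i)^* * ip (x i) u.
Proof.
move=> H; rewrite (ip_conj H) ip_sumr // rmorph_sum; apply: eq_bigr => i _.
by rewrite /= rmorphM /= -(ip_conj H).
Qed.

Lemma bvec_sum (K : fieldType) (V : vectType K) (v : V) :
  v = \sum_i coord (vbasis {:V}) i v *: bvec i.
Proof. exact: coord_vbasis (memvf v). Qed.

Lemma adjoint_exists (V W : vectType C) (ipV : V -> V -> C) (ipW : W -> W -> C)
    (f : 'Hom(V, W)) : inner_product ipV -> inner_product ipW ->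
  exists g : 'Hom(W, V), forall v w, ipW (f v) w = ipV v (g w).
Proof.
move=> HV HW.
pose G : 'M[C]_(\dim {:V}) := \matrix_(i, j) ipV (bvec i) (bvec j).
have Gu : G \in unitmx.
  rewrite -unitmx_tr -row_free_unit; apply/inj_row_free => y yG.
  pose u : V := \sum_j y 0 j *: bvec j.
  have u0 : u = 0.
    apply/eqP; apply: contraT => /(ip_pos HV); rewrite {1}/u ip_suml //.
    rewrite big1 ?ltxx // => i _; rewrite ip_sumr //.
    have := congr1 (fun A : 'rV_ _ => A 0 i) yG; rewrite !mxE => yGi.
    rewrite (_ : \sum_j _ = 0) ?mulr0 // -[RHS]yGi.
    by apply: eq_bigr => j _; rewrite !mxE.
  have /freeP fr := basis_free (vbasisP {:V}).
  by apply/rowP => j; rewrite mxE; exact: fr u0 j.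
pose b w : 'cV[C]_(\dim {:V}) := \col_i ipW (f (bvec i)) w.
have b_lin : linear b.
  by move=> c x y; apply/colP => i; rewrite !mxE (ip_linear HW).
pose g w : V := \sum_j (invmx G *m b w) j 0 *: bvec j.
have g_lin : linear g.
  move=> c x y; rewrite /g scaler_sumr -big_split; apply: eq_bigr => j _ /=.
  by rewrite b_lin mulmxDr -scalemxAr !mxE scalerDl scalerA.
pose gl : {linear W -> V} := HB.pack g (GRing.isLinear.Build C W V *:%R g g_lin).
exists (linfun gl) => v w; rewrite lfunE /= {1 2}[v]bvec_sum linear_sum.
under eq_bigr do rewrite linearZ.
rewrite !ip_suml //; apply: eq_bigr => i _; congr (_ * _).
rewrite /g ip_sumr //.
have := congr1 (fun A : 'cV_ _ => A i 0) (mulKVmx Gu (b w)); rewrite !mxE => <-.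
by apply: eq_bigr => j _; rewrite !mxE mulrC.
Qed.

Lemma adjointP (V W : vectType C) (ipV : V -> V -> C) (ipW : W -> W -> C)
    (f : 'Hom(V, W)) : inner_product ipV -> inner_product ipW ->
  forall v w, ipW (f v) w = ipV v (adjoint ipV ipW f w).
Proof.
move=> HV HW; rewrite /adjoint; case: xgetP => [g _ //|nex].
by have [g /nex] := adjoint_exists f HV HW.
Qed.

End Adjoint.

Section Tensor.
Variable K : fieldType.

(* V (x) W as the space of coefficient arrays in a fixed pair of bases. *)
Definition tensor (V W : vectType K) := 'M[K]_(\dim {:V}, \dim {:W}).

Definition tens (V W : vectType K) (v : V) (w : W) : tensor V W :=
  \matrix_(i, j) (coord (vbasis {:V}) i v * coord (vbasis {:W}) j w).

(* The linear map on V (x) W induced by a bilinear map b; see [tlift_tens]. *)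
Definition tlift (V W U : vectType K) (b : V -> W -> U) : 'Hom(tensor V W, U) :=
  linfun (fun T : tensor V W => \sum_i \sum_j T i j *: b (bvec i) (bvec j)).

Lemma tliftE (V W U : vectType K) (b : V -> W -> U) (T : tensor V W) :
  tlift b T = \sum_i \sum_j T i j *: b (bvec i) (bvec j).
Proof.
pose F (T : tensor V W) := \sum_i \sum_j T i j *: b (bvec i) (bvec j).
have F_lin : linear F.
  move=> c x y; rewrite /F scaler_sumr -big_split; apply: eq_bigr => i _ /=.
  rewrite scaler_sumr -big_split; apply: eq_bigr => j _ /=.
  by rewrite !mxE scalerDl scalerA.
pose Fl : {linear tensor V W -> U} :=
  HB.pack F (GRing.isLinear.Build K (tensor V W) U *:%R F F_lin).
by rewrite -[tlift b]/(linfun Fl) lfunE.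
Qed.

Lemma tlift_tens (V W U : vectType K) (b : V -> W -> U) :
  (forall v, linear (b v)) -> (forall w, linear (b^~ w)) ->
  forall v w, tlift b (tens v w) = b v w.
Proof.
move=> br bl v w; rewrite tliftE.
pose bl' w : {linear V -> U} :=
  HB.pack (b^~ w) (GRing.isLinear.Build K V U *:%R (b^~ w) (bl w)).
pose br' v : {linear W -> U} :=
  HB.pack (b v) (GRing.isLinear.Build K W U *:%R (b v) (br v)).
rewrite -[RHS]/(bl' w v) {2}[v]bvec_sum linear_sum; apply: eq_bigr => i _.
rewrite linearZ /= -[b (bvec i) w]/(br' (bvec i) w) {2}[w]bvec_sum linear_sum.
rewrite scaler_sumr; apply: eq_bigr => j _.
by rewrite linearZ /= mxE scalerA.
Qed.

Definition tensl (V W V' W' : vectType K)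
    (f : 'Hom(V, V')) (g : 'Hom(W, W')) : 'Hom(tensor V W, tensor V' W') :=
  tlift (fun v w => tens (f v) (g w)).

Lemma tensDr (V W : vectType K) (v : V) : linear (@tens V W v).
Proof. by move=> c x y; apply/matrixP => i j; rewrite !mxE linearP /= mulrDr mulrCA. Qed.

Lemma tensDl (V W : vectType K) (w : W) : linear ((@tens V W)^~ w).
Proof. by move=> c x y; apply/matrixP => i j; rewrite !mxE linearP mulrDl -mulrA. Qed.

Lemma tensl_tens (V W V' W' : vectType K) (f : 'Hom(V, V')) (g : 'Hom(W, W')) v w :
  tensl f g (tens v w) = tens (f v) (g w).
Proof.
rewrite /tensl tlift_tens // => [x|y] c a b.
  by rewrite linearP tensDr.
by rewrite linearP tensDl.
Qed.

Lemma tenslDr (V W V' W' : vectType K) (f : 'Hom(V, V')) c (g h : 'Hom(W, W')) :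
  tensl f (c *: g + h) = c *: tensl f g + tensl f h.
Proof.
apply/lfunP => T; rewrite !(add_lfunE, scale_lfunE) !tliftE scaler_sumr -big_split.
apply: eq_bigr => i _ /=; rewrite scaler_sumr -big_split; apply: eq_bigr => j _ /=.
by rewrite !(add_lfunE, scale_lfunE) tensDr scalerDr !scalerA mulrC.
Qed.

Lemma tenslDl (V W V' W' : vectType K) c (f h : 'Hom(V, V')) (g : 'Hom(W, W')) :
  tensl (c *: f + h) g = c *: tensl f g + tensl h g.
Proof.
apply/lfunP => T; rewrite !(add_lfunE, scale_lfunE) !tliftE scaler_sumr -big_split.
apply: eq_bigr => i _ /=; rewrite scaler_sumr -big_split; apply: eq_bigr => j _ /=.
by rewrite !(add_lfunE, scale_lfunE) tensDl scalerDr !scalerA mulrC.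
Qed.

Definition optrace (V : vectType K) (f : 'End(V)) : K :=
  \sum_i coord (vbasis {:V}) i (f (bvec i)).

End Tensor.

(* The inner product on V (x) W with
   <v (x) w, v' (x) w'> = <v, v'> <w, w'>; see [tip_tens]. *)
Definition tip (R : realType) (V W : vectType R[i])
    (ipV : V -> V -> R[i]) (ipW : W -> W -> R[i]) (S T : tensor V W) : R[i] :=
  \sum_i \sum_j \sum_k \sum_l
    (S i j)^* * T k l * (ipV (bvec i) (bvec k) * ipW (bvec j) (bvec l)).

Lemma tip_tens (R : realType) (V W : vectType R[i])
    (ipV : V -> V -> R[i]) (ipW : W -> W -> R[i]) :
  inner_product ipV -> inner_product ipW ->
  forall v w v' w', tip ipV ipW (tens v w) (tens v' w') = ipV v v' * ipW w w'.
Proof.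
move=> HV HW v w v' w'.
rewrite [in RHS](bvec_sum v) [in RHS](bvec_sum w) !ip_suml //.
rewrite mulr_suml; apply: eq_bigr => i _; rewrite mulr_sumr.
apply: eq_bigr => j _; rewrite [in RHS](bvec_sum v') [in RHS](bvec_sum w').
rewrite !ip_sumr // -mulrA mulr_suml mulr_sumr; apply: eq_bigr => k _.
rewrite mulrCA !mulr_sumr; apply: eq_bigr => l _.
by rewrite !mxE rmorphM /=; ring.
Qed.

Section CStar.
Variables (R : realType) (M : cstarAlgType R).
Local Notation C := R[i].

Definition cpositive (a : M) : Prop := exists b : M, a = star b * b.

Definition faithful_positive (Psi : {scalar M}) : Prop :=
  (forall a, cpositive a -> 0 <= Psi a) /\
  (forall a, cpositive a -> Psi a = 0 -> a = 0).

Definition tracial (tr : {scalar M}) : Prop := forall a b, tr (a * b) = tr (b * a).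

(* l ^ w = exp (w ln l), for l > 0 and complex w *)
Definition rcpow (l : R) (w : C) : C :=
  (expR (complex.Re w * ln l))%:C *
  (cos (complex.Im w * ln l) +i* sin (complex.Im w * ln l)).

(* a = \sum_k l k *: p k with l k > 0 and mutually orthogonal self-adjoint
   projections p k adding up to 1. *)
Record spectral_decomp (a : M) n (l : 'I_n -> R) (p : 'I_n -> M) : Prop := {
  sd_pos : forall k, 0 < l k;
  sd_star : forall k, star (p k) = p k;
  sd_orth : forall j k, p j * p k = if j == k then p k else 0;
  sd_one : \sum_k p k = 1;
  sd_sum : a = \sum_k (l k)%:C *: p k
}.

(* Complex powers of a positive invertible element by spectral calculus. The
   value does not depend on the decomposition. *)
Definition cpower (a : M) (w : C) : M :=
  xget 0 [set c | exists n (l : 'I_n -> R) (p : 'I_n -> M),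
    spectral_decomp a l p /\ c = \sum_k rcpow (l k) w *: p k].

(* sigma_z(a) = rho^(i z) a rho^(- i z) *)
Definition modular (rho : M) (z : C) : 'End(M) :=
  (amulr (cpower rho (- ('i%C * z))) \o amull (cpower rho ('i%C * z)))%VF.

Section L2.
Variable Psi : {scalar M}.

Definition L2ip (a b : M) : C := Psi (star a * b).

Definition L2adj (f : 'End(M)) : 'End(M) := adjoint L2ip L2ip f.

Definition mult : 'Hom(tensor M M, M) := tlift (fun a b : M => a * b).

Definition mult_adj : 'Hom(M, tensor M M) :=
  adjoint (tip L2ip L2ip) L2ip mult.

Definition schur (M1 M2 : 'End(M)) : 'End(M) :=
  (mult \o tensl M1 M2 \o mult_adj)%VF.

Lemma schurDr A c X Y : schur A (c *: X + Y) = c *: schur A X + schur A Y.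
Proof.
apply/lfunP => x; rewrite /schur !(comp_lfunE, add_lfunE, scale_lfunE) -linearP.
by congr (mult _); rewrite tenslDr !(add_lfunE, scale_lfunE).
Qed.

Lemma schurDl A c X Y : schur (c *: X + Y) A = c *: schur X A + schur Y A.
Proof.
apply/lfunP => x; rewrite /schur !(comp_lfunE, add_lfunE, scale_lfunE) -linearP.
by congr (mult _); rewrite tenslDl !(add_lfunE, scale_lfunE).
Qed.

Record quantum_system (delta : R) : Prop := {
  qs_state : faithful_positive Psi;
  qs_delta : 0 < delta;
  qs_mult : (mult \o mult_adj)%VF = (delta ^+ 2)%:C *: \1%VF
}.

Record quantum_graph (delta : R) (A : 'End(M)) : Prop := {
  qg_system : quantum_system delta;
  qg_schur : schur A A = (delta ^+ 2)%:C *: A;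
  qg_real : forall x, star (A x) = A (star x);
  qg_adj_real : forall x, star (L2adj A x) = L2adj A (star x)
}.

Definition left_ip (rho : M) (X Y : 'End(M)) : C :=
  optrace (L2adj (modular rho 'i%C \o X) \o Y)%VF.

Definition right_ip (rho : M) (X Y : 'End(M)) : C :=
  optrace (L2adj (X \o modular rho (- 'i%C)) \o Y)%VF.

(* The maps P_A (left) and P_A' (right) of the quantum graph A; see [left_schurE]
   and [right_schurE]. *)
Definition left_schur (delta : R) (A : 'End(M)) : 'End('End(M)) :=
  linfun (fun X : 'End(M) => (delta ^- 2)%:C *: schur A X).

Definition right_schur (delta : R) (A : 'End(M)) : 'End('End(M)) :=
  linfun (fun X : 'End(M) => (delta ^- 2)%:C *: schur X A).

Lemma L2ip_inner_product : faithful_positive Psi -> inner_product L2ip.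
Proof.
move=> [Pge0 Pfaith].
have pos a : cpositive (star a * a) by exists a.
have star0 : star (0 : M) = 0.
  by apply: (addrI (star (0 : M))); rewrite -starD !addr0.
have L2D u v w : L2ip u (v + w) = L2ip u v + L2ip u w.
  by rewrite /L2ip mulrDr raddfD.
have L2Z u c v : L2ip u (c *: v) = c * L2ip u v.
  by rewrite /L2ip -scalerAr linearZ.
have L2Dl u v w : L2ip (u + v) w = L2ip u w + L2ip v w.
  by rewrite /L2ip starD mulrDl raddfD.
have L2Zl u c v : L2ip (c *: u) v = c^* * L2ip u v.
  by rewrite /L2ip starZ -scalerAl linearZ.
have L2real u : complex.Im (L2ip u u) = 0.
  have := Pge0 _ (pos u); rewrite -/(L2ip u u); case: (L2ip u u) => x y.
  by rewrite lecE /= => /andP[/eqP].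
split=> [u c v w|u v|u u0]; first by rewrite L2D L2Z.
- have := L2real (u + v); have := L2real (u + 'i%C *: v).
  rewrite !(L2D, L2Dl, L2Z, L2Zl).
  move: (L2real u) (L2real v).
  case: (L2ip u u) (L2ip v v) (L2ip u v) (L2ip v u) => [a b] [c d] [e f] [g h].
  rewrite /= => -> ->; simpc => /= E1 E2.
  by congr (_ +i* _); lra.
- rewrite lt_neqAle Pge0 // andbT eq_sym; apply: contra u0 => /eqP /(Pfaith _ (pos u)).
  move=> uu; apply/eqP/cnorm0_eq0/eqP; rewrite -sqrf_eq0 -cnorm_star uu.
  have := cnormZ 0 (0 : M); rewrite scale0r normr0 mul0r.
  by move=> /eqP; rewrite eq_complex /= eqxx andbT.
Qed.

Lemma mult_tens a b : mult (tens a b) = a * b.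
Proof.
rewrite /mult tlift_tens // => [v c x y|w c x y].
  by rewrite mulrDr scalerAr.
by rewrite mulrDl scalerAl.
Qed.

Lemma left_schurE delta A X :
  left_schur delta A X = (delta ^- 2)%:C *: schur A X.
Proof.
have lin : linear (fun X : 'End(M) => (delta ^- 2)%:C *: schur A X).
  by move=> c Y Z; rewrite schurDr scalerDr !scalerA mulrC.
pose l : {linear 'End(M) -> 'End(M)} := HB.pack (fun X : 'End(M) => _)
  (GRing.isLinear.Build C 'End(M) 'End(M) *:%R _ lin).
by rewrite -[left_schur delta A]/(linfun l) lfunE.
Qed.

Lemma right_schurE delta A X :
  right_schur delta A X = (delta ^- 2)%:C *: schur X A.
Proof.
have lin : linear (fun X : 'End(M) => (delta ^- 2)%:C *: schur X A).
  by move=> c Y Z; rewrite schurDl scalerDr !scalerA mulrC.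
pose l : {linear 'End(M) -> 'End(M)} := HB.pack (fun X : 'End(M) => _)
  (GRing.isLinear.Build C 'End(M) 'End(M) *:%R _ lin).
by rewrite -[right_schur delta A]/(linfun l) lfunE.
Qed.

End L2.
End CStar.

(* Main.v *)
From HB Require Import structures.
Require Import Defs.
From mathcomp Require Import all_boot all_order all_algebra all_field.
From mathcomp Require Import complex.
From mathcomp Require Import boolp classical_sets reals sequences exp trigo.

Set Implicit Arguments.
Unset Strict Implicit.
Unset Printing Implicit Defensive.

Import Order.TTheory GRing.Theory Num.Theory.
Local Open Scope ring_scope.
Local Open Scope complex_scope.

(** Write |e><f| for the map x |-> <f, x> e, L_a and R_a for left and right
    multiplication by a, and s for the modular automorphism
    s(a) = rho a rho^-1, so that the KMS relation Psi (a b) = Psi (b s(a))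
    holds and star (s(a)) = s^-1 (star a).

    The adjoint m^dag contracts with a vector f in one leg to a multiplication:
    (<f| (x) id) m^dag = L_{star f}, because <f y, x> = <y, star f * x>, and
    (id (x) <f|) m^dag = R_{s(star f)} by the KMS relation. Hence, for every
    decomposition A = sum_k |e_k><f_k|, the Schur products with A are
      A ._S X = sum_k L_{e_k} X L_{star f_k},
      X ._S A = sum_k R_{e_k} X R_{s(star f_k)}
    (schur_ketbral, schur_ketbrar).

    The operator s is self-adjoint on L^2, the adjoint of L_a is L_{star a} and
    that of R_a is R_{s(star a)}, and conjugating L_a or R_a by s gives L_{s(a)}
    or R_{s(a)}. Cyclicity of the trace then shows that the adjoint of A ._S _ for
    the left scalar product, and that of _ ._S A for the right one, is the
    Schur product with
      A' = sum_k |s(star e_k)><star f_k|.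

    Finally A' = A. Reality of A rewrites A' as s A s^-1, and A commutes with s
    because both A and its adjoint commute with the antilinear map star, while
    <star x, s y> = <star y, x> expresses s through star and the inner product
    (real_comm_s, ketbra_sum_real).

    The powers rho^{1} and rho^{-1} in s and s^-1 are defined by spectral
    calculus, so a spectral decomposition of rho has to be produced first. It is
    enough to write 1 as a sum of eigenvectors p_z of L_rho for distinct
    eigenvalues z: positivity of rho makes the z positive and the p_z mutually
    orthogonal, in the sense that star p_z * p_w = 0; multiplying 1 = sum_w p_w
    by star p_z gives star p_z = star p_z * p_z, so that the p_z are the spectral
    projections. *)

(** * Splitting a vector into eigenvectors *)

(** The powers of a are linearly dependent, so some nonzero polynomial kills a;
    over a closed field it splits, and its leading coefficient can be dropped. *)
Lemma root_annihilator (F : closedFieldType) (E : falgType F) (a : E) :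
  exists s : seq F, \prod_(z <- s) (a - z%:A) = 0.
Proof.
pose d := \dim {:E}.
pose ev (v : 'rV[F]_d.+1) := horner_alg a (rVpoly v).
have ev_lin : linear ev.
  by move=> c u v; rewrite /ev /= !linearP /= mulr_algl.
pose evl : {linear 'rV[F]_d.+1 -> E} :=
  HB.pack ev (GRing.isLinear.Build F 'rV[F]_d.+1 E *:%R ev ev_lin).
have [v v0 av] : exists2 v : 'rV[F]_d.+1, v != 0 & ev v = 0.
  have : lker (linfun evl) != 0%VS.
    apply/eqP => ker0; have := limg_ker_dim (linfun evl) fullv.
    rewrite ker0 capv0 dimv0 add0n => dimE.
    have := dimvS (subvf (linfun evl @: fullv)).
    by rewrite dimE dimvf dim_matrix mul1r ltnn.
  rewrite -vpick0 => v0; exists (vpick (lker (linfun evl))) => //.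
  by have := memv_pick (lker (linfun evl)); rewrite memv_ker lfunE => /eqP.
have p0 : rVpoly v != 0.
  by apply: contraNneq v0 => pv0; rewrite -[v]rVpolyK pv0 linear0.
have [s ps] := closed_field_poly_normal (rVpoly v); exists s.
have : horner_alg a (rVpoly v) = 0 by [].
rewrite ps linearZ /= rmorph_prod /= mulr_algl => /eqP.
rewrite scaler_eq0 lead_coef_eq0 (negPf p0) /= => /eqP <-.
by apply: eq_bigr => z _; rewrite rmorphB /= horner_algX horner_algC.
Qed.

Section EigenSum.
Variables (F : fieldType) (E : falgType F) (a : E).
Hypothesis semisimple : forall z x,
  (a - z%:A) * ((a - z%:A) * x) = 0 -> (a - z%:A) * x = 0.

(** Induction on the list of roots. If (a - w) x is a sum of eigenvectors f z,
    subtracting f z / (z - w) from x for all z != w leaves a vector x' with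
    (a - w) x' an eigenvector for w or zero. Then (a - w)^2 x' = 0, and
    semisimplicity makes x' an eigenvector for w. *)
Lemma eigen_sum (s : seq F) (x : E) : \prod_(z <- s) (a - z%:A) * x = 0 ->
  exists (t : seq F) (f : F -> E),
    [/\ uniq t, forall z, a * f z = z *: f z & x = \sum_(z <- t) f z].
Proof.
elim/last_ind: s x => [|s w IH] x.
  by rewrite big_nil mul1r => ->; exists [::], (fun=> 0);
     split=> // [z|]; rewrite ?mulr0 ?scaler0 ?big_nil.
rewrite -cats1 big_cat big_seq1 /= -mulrA => /IH[t [f [ut fE yE]]].
have eigB z u : a * u = z *: u -> (a - w%:A) * u = (z - w) *: u.
  by move=> au; rewrite mulrBl au mulr_algl scalerBl.
pose g z := (z - w)^-1 *: f z.
pose x' := x - \sum_(z <- t | z != w) g z.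
have x'E : (a - w%:A) * x' = if w \in t then f w else 0.
  rewrite mulrBr yE mulr_sumr (bigID (pred1 w)) /=.
  rewrite [X in _ + X - _](eq_bigr (fun z => (a - w%:A) * g z)); last first.
    move=> z zw; rewrite -scalerAr (eigB _ _ (fE z)) scalerA mulVf ?scale1r //.
    by rewrite subr_eq0.
  rewrite addrK; case: ifP => wt.
    by rewrite -big_filter filter_pred1_uniq // big_seq1.
  by rewrite big1_seq // => z /andP[/= /eqP->]; rewrite wt.
have ax' : a * x' = w *: x'.
  apply/eqP; rewrite -subr_eq0 -[w *: x']mulr_algl -mulrBl; apply/eqP.
  apply: semisimple; rewrite x'E; case: ifP => _; last by rewrite mulr0.
  by rewrite (eigB _ _ (fE w)) subrr scale0r.
exists (w :: [seq z <- t | z != w]), (fun z => if z == w then x' else g z).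
split=> [|z|].
- by rewrite /= mem_filter eqxx filter_uniq.
- case: eqP => [->|_] //.
  by rewrite -scalerAr fE !scalerA mulrC.
- rewrite big_cons eqxx big_filter (eq_bigr g) ?subrK // => z /negPf -> //.
Qed.

End EigenSum.

(** * The spectral decomposition of a positive invertible element *)

Section Spectral.
Variables (R : realType) (M : cstarAlgType R).
Local Notation C := R[i].
Implicit Types (x y : M) (z : C).

(** The form of [starZ], which is about [Num.conj], for the conjugation [conjc]
    of the inner products. *)
Lemma starZc z x : star (z *: x) = conjc z *: star x.
Proof. exact: starZ. Qed.

Lemma starB x y : star (x - y) = star x - star y.
Proof. by rewrite -scaleN1r starD starZ rmorphN1 scaleN1r. Qed.

Lemma star0 : star (0 : M) = 0.
Proof. by rewrite -{1}(subrr (0 : M)) starB subrr. Qed.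

Lemma star_sum (I : Type) (r : seq I) (P : pred I) (f : I -> M) :
  star (\sum_(i <- r | P i) f i) = \sum_(i <- r | P i) star (f i).
Proof. exact: (big_morph star (@starD R M) star0). Qed.

Lemma star1 : star (1 : M) = 1.
Proof. by rewrite -[LHS]mulr1 -{2}(starK 1) -starM mulr1 starK. Qed.

Lemma star_inv x : x \is a GRing.unit -> star x = x -> star x^-1 = x^-1.
Proof.
move=> ux xs; apply: (mulrI ux).
by rewrite mulrV // -{1}xs -starM mulVr // star1.
Qed.

Lemma cpositive_star x : cpositive x -> star x = x.
Proof. by case=> b ->; rewrite starM starK. Qed.

Lemma star_mul_eq0 x : star x * x = 0 -> x = 0.
Proof.
move=> x0; apply: cnorm0_eq0; apply/eqP; rewrite -sqrf_eq0 -cnorm_star x0.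
have := cnormZ 0 (0 : M); rewrite scale0r normr0 mul0r.
by move=> /eqP; rewrite eq_complex /= eqxx andbT.
Qed.

(** A self-adjoint element has no nontrivial Jordan blocks, by the C*-identity
    applied to h x. *)
Lemma selfadjoint_mul_eq0 h x : star h = h -> h * (h * x) = 0 -> h * x = 0.
Proof.
by move=> hs hhx; apply: star_mul_eq0; rewrite starM hs -mulrA hhx mulr0.
Qed.

Variables (phi : {scalar M}) (rho : M).
Hypotheses (phiP : faithful_positive phi).
Hypotheses (rho_pos : cpositive rho) (rho_unit : rho \is a GRing.unit).

(** With rho = star b * b, phi (star (b x) * (b x)) = z phi (star x * x). *)
Lemma eigenvalue_pos z x : x != 0 -> rho * x = z *: x -> 0 < z.
Proof.
case: phiP => pge0 pf x0 xz; have [b rhoE] := rho_pos.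
have sq y : cpositive (star y * y) by exists y.
have xx : 0 < phi (star x * x).
  rewrite lt_neqAle pge0 // andbT eq_sym; apply: contra x0 => /eqP.
  by move=> /(pf _ (sq _)) /star_mul_eq0 ->.
have z0 : z != 0.
  apply: contraNneq x0 => z0; move: xz; rewrite z0 scale0r.
  by move=> /(congr1 ( *%R rho^-1)); rewrite mulKr // mulr0 => ->.
rewrite lt_neqAle eq_sym z0 /= -(pmulr_lge0 _ xx) mulrC.
have -> : phi (star x * x) * z = phi (star (b * x) * (b * x)).
  by rewrite starM -mulrA [star b * _]mulrA -rhoE xz -scalerAr linearZ /= mulrC.
exact: pge0.
Qed.

Lemma posC_real z : 0 < z -> z = (complex.Re z)%:C /\ 0 < complex.Re z.
Proof. by case: z => u v; rewrite ltcE /= => /andP[/eqP-> ?]. Qed.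

Lemma posC_conj z : 0 < z -> conjc z = z.
Proof. by move=> /posC_real[-> _] /=; rewrite oppr0. Qed.

(** Since z is real, rho acts on star x * rho * y both as z, from the left, and
    as w, from the right. *)
Lemma eigenvectors_orth z w x y : rho * x = z *: x -> rho * y = w *: y ->
  z != w -> star x * y = 0.
Proof.
have [->|x0] := eqVneq x 0; first by rewrite star0 mul0r.
move=> xz yw zw; have zr := posC_conj (eigenvalue_pos x0 xz).
have sx : star x * rho = z *: star x.
  by rewrite -{1}(cpositive_star rho_pos) -starM xz starZc zr.
apply/eqP; have: (z - w) *: (star x * y) = 0.
  by rewrite scalerBl scalerAl -sx scalerAr -yw mulrA subrr.
by move/eqP; rewrite scaler_eq0 subr_eq0 (negPf zw).
Qed.

Lemma spectral_decomp_exists :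
  exists n (l : 'I_n -> R) (p : 'I_n -> M), spectral_decomp rho l p.
Proof.
have rhoS := cpositive_star rho_pos.
have ss z x : (rho - z%:A) * ((rho - z%:A) * x) = 0 -> (rho - z%:A) * x = 0.
  move=> xz; pose y := (rho - z%:A) * x.
  have [//|y0] := eqVneq y 0.
  have yz : rho * y = z *: y.
    by apply/eqP; rewrite -subr_eq0 -[z *: y]mulr_algl -mulrBl xz.
  have zr := posC_conj (eigenvalue_pos y0 yz).
  apply: selfadjoint_mul_eq0 xz.
  by rewrite starB rhoS starZc star1 zr.
(* Some eigencomponents of 1 may vanish, and only the eigenvalues with a
   nonzero one are known to be positive. *)
have [s s0] := root_annihilator rho.
have := @eigen_sum _ _ rho ss s 1; rewrite s0 mul0r.
move=> /(_ erefl) [t [f [ut fE oneE]]].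
pose t' := [seq z <- t | f z != 0].
have ut' : uniq t' by rewrite filter_uniq.
have one' : 1 = \sum_(k < size t') f t'`_k.
  rewrite oneE (bigID (fun z => f z != 0)) /= [X in _ + X]big1 ?addr0; last first.
    by move=> z; rewrite negbK => /eqP.
  by rewrite -big_filter (big_nth 0) big_mkord.
have tpos (k : 'I_(size t')) : 0 < t'`_k.
  have: t'`_k \in t' by rewrite mem_nth.
  by rewrite mem_filter => /andP[fk _]; apply: eigenvalue_pos fk (fE _).
pose l (k : 'I_(size t')) := complex.Re t'`_k.
pose p (k : 'I_(size t')) := f t'`_k.
have orth (j k : 'I_(size t')) : j != k -> star (p j) * p k = 0.
  by move=> jk; apply: eigenvectors_orth (fE _) (fE _) _; rewrite nth_uniq.
have psq j : star (p j) = star (p j) * p j.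
  rewrite -[LHS]mulr1 one' mulr_sumr (bigD1 j) //= big1 ?addr0 // => k kj.
  by apply: orth; rewrite eq_sym.
have ps j : star (p j) = p j by rewrite -[RHS]starK psq starM starK -psq.
exists (size t'), l, p; split=> //.
- by move=> k; case: (posC_real (tpos k)).
- move=> j k; case: eqVneq => [->|jk]; last by rewrite -[p j]ps orth.
  by rewrite -{1}[p k]ps -psq ps.
rewrite -[LHS]mulr1 one' mulr_sumr; apply: eq_bigr => k _.
by rewrite fE -(posC_real (tpos k)).1.
Qed.

Lemma cpower_spectral w : exists n (l : 'I_n -> R) (p : 'I_n -> M),
  spectral_decomp rho l p /\ cpower rho w = \sum_k rcpow (l k) w *: p k.
Proof.
rewrite /cpower; case: xgetP => [c _ //|nex].
have [n [l [p lp]]] := spectral_decomp_exists.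
by case: (nex (\sum_k rcpow (l k) w *: p k)); exists n, l, p.
Qed.

Lemma rcpow_real (l u : R) : rcpow l u%:C = (expR (u * ln l))%:C.
Proof. by rewrite /rcpow /= mul0r cos0 sin0 mulr1. Qed.

(** The powers 1 and -1 do not depend on the decomposition chosen in [cpower]:
    they are rho and its inverse for every one of them. *)
Lemma cpower1 : cpower rho 1 = rho.
Proof.
have [n [l [p [lp ->]]]] := cpower_spectral 1.
rewrite (sd_sum lp); apply: eq_bigr => k _.
by rewrite (rcpow_real _ 1) mul1r lnK // posrE (sd_pos lp).
Qed.

Lemma cpowerN1 : cpower rho (-1) = rho^-1.
Proof.
have [n [l [p [lp ->]]]] := cpower_spectral (-1).
apply: (mulrI rho_unit); rewrite mulrV // {1}(sd_sum lp) -(sd_one lp).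
rewrite mulr_suml; apply: eq_bigr => k _.
rewrite mulr_sumr (bigD1 k) //= big1 ?addr0 => [|j jk]; last first.
  by rewrite -scalerAr -scalerAl (sd_orth lp) eq_sym (negPf jk) !scaler0.
rewrite -scalerAr -scalerAl (sd_orth lp) eqxx scalerA -(rmorphN1 (real_complex R)).
rewrite rcpow_real mulN1r expRN lnK ?posrE ?(sd_pos lp) // -rmorphM /=.
by rewrite mulVf ?scale1r // gt_eqF // (sd_pos lp).
Qed.

Lemma modular_iE x : modular rho 'i%C x = rho^-1 * x * rho.
Proof.
rewrite /modular comp_lfunE !lfunE /=.
congr (_ * x * _); first by rewrite -cpowerN1 -expr2 sqr_i.
by rewrite -[RHS]cpower1 -expr2 sqr_i opprK.
Qed.

Lemma modular_NiE x : modular rho (- 'i%C) x = rho * x * rho^-1.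
Proof.
rewrite /modular mulrN comp_lfunE !lfunE /=.
congr (_ * x * _); first by rewrite -[RHS]cpower1 -expr2 sqr_i opprK.
by rewrite -cpowerN1 -expr2 sqr_i opprK.
Qed.

End Spectral.

(** * The operator trace *)

Section Trace.
Variables (K : fieldType) (V : vectType K).
Implicit Types f g : 'End(V).

Lemma optraceZ c f : optrace (c *: f) = c * optrace f.
Proof.
rewrite /optrace mulr_sumr; apply: eq_bigr => i _.
by rewrite scale_lfunE linearZ.
Qed.

Lemma optraceD f g : optrace (f + g) = optrace f + optrace g.
Proof.
rewrite /optrace -big_split; apply: eq_bigr => i _ /=.
by rewrite add_lfunE linearD.
Qed.

Lemma optrace_sum (I : finType) (F : I -> 'End(V)) :
  optrace (\sum_i F i) = \sum_i optrace (F i).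
Proof.
rewrite /optrace exchange_big; apply: eq_bigr => i _ /=.
by rewrite sum_lfunE linear_sum.
Qed.

Lemma optraceC f g : optrace (f \o g)%VF = optrace (g \o f)%VF.
Proof.
have tr2 h k : optrace (h \o k)%VF = \sum_i \sum_j
    coord (vbasis {:V}) j (k (bvec i)) * coord (vbasis {:V}) i (h (bvec j)).
  apply: eq_bigr => i _; rewrite comp_lfunE {1}[k _]bvec_sum !linear_sum.
  by apply: eq_bigr => j _; rewrite !linearZ.
rewrite !tr2 exchange_big; apply: eq_bigr => i _; apply: eq_bigr => j _.
exact: mulrC.
Qed.

(** Testing against the matrix units of the chosen basis reads off the
    coordinates of f. *)
Lemma optrace_eq0 f : (forall g, optrace (g \o f)%VF = 0) -> f = 0.
Proof.
move=> f0; suff fb j : f (bvec j) = 0.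
  apply/lfunP => v; rewrite zero_lfunE [v]bvec_sum linear_sum.
  by apply: big1 => j _; rewrite linearZ /= fb scaler0.
rewrite [LHS]bvec_sum; apply: big1 => i _.
pose h (w : V) := coord (vbasis {:V}) i w *: bvec j.
have h_lin : linear h by move=> c x y; rewrite /h linearP scalerDl scalerA.
pose hl : {linear V -> V} := HB.pack h (GRing.isLinear.Build K V V *:%R h h_lin).
have [g gE] : exists g : 'End(V), forall w, g w = h w.
  by exists (linfun hl) => w; rewrite lfunE.
have fr k : coord (vbasis {:V}) k (bvec j) = (k == j)%:R.
  by rewrite coord_free ?(basis_free (vbasisP _)) // eq_sym.
have := f0 g; rewrite /optrace (bigD1 j) //= big1 => [|k kj].
  by rewrite addr0 comp_lfunE gE linearZ /= fr eqxx mulr1 => ->; rewrite scale0r.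
by rewrite comp_lfunE gE linearZ /= fr (negPf kj) mulr0.
Qed.

End Trace.

Section CompSum.
Variables (K : fieldType) (U V W : vectType K) (I : finType).

Lemma comp_lfun_suml (F : I -> 'Hom(V, W)) (g : 'Hom(U, V)) :
  ((\sum_i F i) \o g)%VF = \sum_i (F i \o g)%VF.
Proof.
exact: (big_morph (fun f => (f \o g)%VF) (fun _ _ => comp_lfunDl _ _ _)
  (comp_lfun0l _ _)).
Qed.

Lemma comp_lfun_sumr (f : 'Hom(V, W)) (G : I -> 'Hom(U, V)) :
  (f \o \sum_i G i)%VF = \sum_i (f \o G i)%VF.
Proof.
exact: (big_morph (fun g => (f \o g)%VF) (fun _ _ => comp_lfunDr _ _ _)
  (comp_lfun0r _ _)).
Qed.

End CompSum.

(** * Adjoints and rank-one decompositions on L^2 *)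

Section L2Space.
Variables (R : realType) (M : cstarAlgType R) (Psi : {scalar M}).
Local Notation C := R[i].
Local Notation "<< x , y >>" := (L2ip Psi x y).
Local Notation adj := (L2adj Psi).
Local Notation e_ := (@bvec C M).
Implicit Types (x y a b : M) (X Y A : 'End(M)).

Hypothesis PsiP : faithful_positive Psi.
Let ipP := L2ip_inner_product PsiP.

Lemma L2ip_linear x : linear_for *%R (L2ip Psi x).
Proof. exact: ip_linear ipP x. Qed.

Lemma L2ipB x y z : <<x, y - z>> = <<x, y>> - <<x, z>>.
Proof. by rewrite -scaleN1r addrC L2ip_linear mulN1r addrC. Qed.

Lemma L2ip_inj a b : (forall x, <<x, a>> = <<x, b>>) -> a = b.
Proof.
move=> ab; apply/eqP; rewrite -subr_eq0; apply: contraT => /(ip_pos ipP).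
by rewrite L2ipB ab subrr ltxx.
Qed.

Lemma L2adjP X x y : <<X x, y>> = <<x, adj X y>>.
Proof. exact: adjointP. Qed.

Lemma L2adj_unique X Y : (forall x y, <<X x, y>> = <<x, Y y>>) -> adj X = Y.
Proof. by move=> XY; apply/lfunP => y; apply: L2ip_inj => x; rewrite -L2adjP. Qed.

Lemma L2adjK X : adj (adj X) = X.
Proof.
apply: L2adj_unique => x y.
by rewrite (ip_conj ipP) -L2adjP -(ip_conj ipP).
Qed.

Lemma L2adj_comp X Y : adj (X \o Y) = (adj Y \o adj X)%VF.
Proof. by apply: L2adj_unique => x y; rewrite !comp_lfunE !L2adjP. Qed.

Lemma L2adjZ c X : adj (c *: X) = conjc c *: adj X.
Proof.
apply: L2adj_unique => x y; rewrite !scale_lfunE.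
have ipZ a b k : <<a, k *: b>> = k * <<a, b>>.
  by rewrite -[k *: b]addr0 L2ip_linear /L2ip mulr0 linear0 addr0.
by rewrite ipZ -L2adjP (ip_conj ipP) ipZ rmorphM /= -(ip_conj ipP).
Qed.

Lemma L2adj_sum (I : finType) (F : I -> 'End(M)) :
  adj (\sum_i F i) = \sum_i adj (F i).
Proof.
apply: L2adj_unique => x y; rewrite !sum_lfunE.
under eq_bigr do rewrite -[F _ x]scale1r.
under [in RHS]eq_bigr do rewrite -[adj _ y]scale1r.
rewrite ip_suml // ip_sumr //; apply: eq_bigr => i _.
by rewrite rmorph1 !mul1r L2adjP.
Qed.

Lemma L2adj_amull a : adj (amull a) = amull (star a).
Proof.
by apply: L2adj_unique => x y; rewrite !lfunE /= /L2ip starM mulrA.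
Qed.

(** The representing vector is the adjoint of phi, as a map into the
    one-dimensional space C, at 1. *)
Lemma riesz (phi : {scalar M}) : exists f, forall x, phi x = <<f, x>>.
Proof.
pose ip1 (a b : C^o) : C := conjc a * b.
have ip1P : inner_product ip1.
  split=> [u c v w|u v|u u0].
  - by rewrite /ip1 mulrDr /= mulrCA.
  - by rewrite /ip1 rmorphM /= conjcK mulrC.
  - by rewrite /ip1 lt_neqAle eq_sym mulf_neq0 ?conjc_eq0 // mulrC mul_conjC_ge0.
pose phil : 'Hom(M, C^o) := linfun (phi : {linear M -> C^o}).
exists (adjoint (L2ip Psi) ip1 phil 1) => x.
by rewrite (ip_conj ipP) -(adjointP phil ipP ip1P) lfunE /ip1 mulr1 conjcK.
Qed.

(** In bra-ket notation, A = \sum_k |e k><f k|. *)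
Definition ketbra_sum (I : finType) (e f : I -> M) A :=
  forall x, A x = \sum_k <<f k, x>> *: e k.

(** The f k represent the coordinate functionals of the basis. *)
Lemma ketbra_sum_exists A :
  exists f, ketbra_sum (fun k : 'I_(\dim {:M}) => A (e_ k)) f A.
Proof.
have /choice[f fE] : forall k : 'I_(\dim {:M}), exists f, forall x,
    coord (vbasis {:M}) k x = <<f, x>>.
  by move=> k; have [f fE] := riesz (coord (vbasis {:M}) k); exists f.
exists f => x; rewrite {1}[x]bvec_sum linear_sum; apply: eq_bigr => k _.
by rewrite linearZ fE.
Qed.

(** * Schur products as sums of two-sided multiplications *)

Lemma tip_tensl (T : tensor M M) x y :
  tip (L2ip Psi) (L2ip Psi) (tens x y) T =
  \sum_k \sum_l T k l * (<<x, e_ k>> * <<y, e_ l>>).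
Proof.
rewrite /tip pair_big /= exchange_big; apply: eq_bigr => k _ /=.
rewrite exchange_big; apply: eq_bigr => l _ /=.
rewrite [x in RHS]bvec_sum [y in RHS]bvec_sum !ip_suml // big_distrlr /=.
rewrite pair_big mulr_sumr; apply: eq_bigr => -[i j] _ /=.
by rewrite !mxE rmorphM /= [in RHS]mulrACA [RHS]mulrCA mulrA.
Qed.

Lemma mult_tensl (A B : 'End(M)) (T : tensor M M) :
  mult M (tensl A B T) = \sum_i \sum_j T i j *: (A (e_ i) * B (e_ j)).
Proof.
rewrite /tensl [tlift _ T]tliftE linear_sum; apply: eq_bigr => i _.
rewrite linear_sum; apply: eq_bigr => j _.
by rewrite linearZ; congr (_ *: _); apply: mult_tens.
Qed.

Variable delta : R.
Hypothesis system : quantum_system Psi delta.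

(** If [mult] had no adjoint, [mult_adj] would be 0, against
    m m^dag = delta^2 id. *)
Lemma mult_adjP (T : tensor M M) x :
  <<mult M T, x>> = tip (L2ip Psi) (L2ip Psi) T (mult_adj Psi x).
Proof.
have := qs_mult system; rewrite /mult_adj /adjoint.
case: xgetP => [g _ gP _|_]; first exact: gP.
rewrite comp_lfun0r => /lfunP /(_ 1); rewrite zero_lfunE scale_lfunE id_lfunE.
move/esym/eqP; rewrite scaler_eq0 oner_eq0 orbF => d0.
have /eqP := d0; rewrite rmorphXn /= => /eqP; rewrite expf_eq0 /=.
by rewrite eq_complex /= eqxx andbT gt_eqF // (qs_delta system).
Qed.

(** (<f| (x) id) m^dag = L_{star f}, since <f y, x> = <y, star f * x>. *)
Lemma mult_adj_contractl f x :
  \sum_i \sum_j (mult_adj Psi x i j * <<f, e_ i>>) *: e_ j = star f * x.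
Proof.
apply: L2ip_inj => y; have -> : <<y, star f * x>> = <<f * y, x>>.
  by rewrite /L2ip starM mulrA.
rewrite -mult_tens mult_adjP tip_tensl pair_big ip_sumr // pair_big.
by apply: eq_bigr => -[i j] _ /=; rewrite mulrA.
Qed.

(** * The modular automorphism *)

(* s is sigma_{-i} and si, below, is sigma_i; the KMS relation ties them to
   Psi. *)
Variable s : 'End(M).
Hypothesis s_kms : forall a b, Psi (a * b) = Psi (b * s a).

(** (id (x) <f|) m^dag = R_{s(star f)}: the KMS relation moves star f from the
    left end of Psi (star f * star y * x) to the right end. *)
Lemma mult_adj_contractr f x :
  \sum_i \sum_j (mult_adj Psi x i j * <<f, e_ j>>) *: e_ i = x * s (star f).
Proof.
apply: L2ip_inj => y; have -> : <<y, x * s (star f)>> = <<y * f, x>>.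
  by rewrite /L2ip mulrA -s_kms starM mulrA.
rewrite -mult_tens mult_adjP tip_tensl pair_big ip_sumr // pair_big.
by apply: eq_bigr => -[i j] _ /=; rewrite mulrAC mulrA.
Qed.

Section KetBra.
Variables (I : finType) (e f : I -> M) (A X : 'End(M)).
Hypothesis A_ef : ketbra_sum e f A.

Lemma schur_ketbral : schur Psi A X =
  \sum_k (amull (e k) \o (X \o amull (star (f k))))%VF.
Proof.
apply/lfunP => x; rewrite /schur sum_lfunE !comp_lfunE mult_tensl.
under [RHS]eq_bigr do rewrite !comp_lfunE !lfunE /= -mult_adj_contractl.
under [RHS]eq_bigr do rewrite pair_big linear_sum mulr_sumr.
rewrite pair_big [RHS]exchange_big; apply: eq_bigr => -[i j] _ /=.
rewrite A_ef mulr_suml scaler_sumr; apply: eq_bigr => k _.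
by rewrite linearZ -scalerAl -scalerAr scalerA.
Qed.

Lemma schur_ketbrar : schur Psi X A =
  \sum_k (amulr (e k) \o (X \o amulr (s (star (f k)))))%VF.
Proof.
apply/lfunP => x; rewrite /schur sum_lfunE !comp_lfunE mult_tensl.
under [RHS]eq_bigr do rewrite !comp_lfunE !lfunE /= -mult_adj_contractr.
under [RHS]eq_bigr do rewrite pair_big linear_sum mulr_suml.
rewrite pair_big [RHS]exchange_big; apply: eq_bigr => -[i j] _ /=.
rewrite A_ef mulr_sumr scaler_sumr; apply: eq_bigr => k _.
by rewrite linearZ -scalerAl -scalerAr scalerA.
Qed.

End KetBra.

Variable si : 'End(M).
Hypotheses (sK : cancel s si) (siK : cancel si s).
Hypothesis sM : {morph s : a b / a * b}.
Hypothesis s_star : forall a, star (s a) = si (star a).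

Lemma L2adj_s : adj s = s.
Proof.
apply: L2adj_unique => x y.
by rewrite /L2ip s_star -[RHS]s_kms [LHS]s_kms siK.
Qed.

Lemma L2adj_si : adj si = si.
Proof.
apply: L2adj_unique => x y.
by rewrite -{1}[y]siK -{1}L2adj_s -L2adjP siK.
Qed.

Lemma L2adj_amulr a : adj (amulr a) = amulr (s (star a)).
Proof.
apply: L2adj_unique => x y; rewrite !lfunE /= /L2ip starM -mulrA s_kms.
by rewrite mulrA.
Qed.

Lemma comp_amulr_s a : (s \o amulr a)%VF = (amulr (s a) \o s)%VF.
Proof. by apply/lfunP => x; rewrite !comp_lfunE !lfunE /= sM. Qed.

Lemma comp_amull_si a : (amull a \o si)%VF = (si \o amull (s a))%VF.
Proof.
apply/lfunP => x; rewrite !comp_lfunE !lfunE /=.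
by apply: (can_inj sK); rewrite sM !siK.
Qed.

(** * Real maps *)

Section RealMap.
Variable A : 'End(M).
Hypothesis A_real : forall x, star (A x) = A (star x).
Hypothesis A_adj_real : forall x, star (adj A x) = adj A (star x).

(** Since <star x, s y> = <star y, x>, with B the adjoint of A,
    <y, s (A x)> = <A (star x), star y> = <star x, B (star y)> = <B y, s x>. *)
Lemma real_comm_s x : A (s x) = s (A x).
Proof.
have swap a b : <<star a, s b>> = <<star b, a>>.
  by rewrite /L2ip !starK -s_kms.
apply: L2ip_inj => y; rewrite -{2}[y]starK [RHS]swap A_real L2adjP.
by rewrite -[RHS]swap A_adj_real starK L2adjP L2adjK.
Qed.

(** The right-hand side is the decomposition of s o star o A o star o s^-1,
    which is A by reality and [real_comm_s]. *)
Lemma ketbra_sum_real (I : finType) (e f : I -> M) : ketbra_sum e f A ->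
  ketbra_sum (fun k => s (star (e k))) (fun k => star (f k)) A.
Proof.
move=> A_ef x; rewrite -{1}[x]siK real_comm_s -[x in LHS]starK -s_star -A_real.
rewrite A_ef star_sum linear_sum; apply: eq_bigr => k _.
rewrite starZc linearZ /=; congr (_ *: _).
by rewrite -(ip_conj ipP) /L2ip s_star !starK [LHS]s_kms siK.
Qed.

(** Expand A as \sum_k |e k><f k| on the left-hand side and as the decomposition
    of [ketbra_sum_real] on the right-hand side: the sums then agree term by
    term. *)
Lemma left_selfadjoint X Y :
  optrace (adj (si \o schur Psi A X) \o Y)%VF =
  optrace (adj (si \o X) \o schur Psi A Y)%VF.
Proof.
have [f A_ef] := ketbra_sum_exists A.
rewrite (schur_ketbral X A_ef) (schur_ketbral Y (ketbra_sum_real A_ef)).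
rewrite comp_lfun_sumr L2adj_sum comp_lfun_suml comp_lfun_sumr !optrace_sum.
apply: eq_bigr => k _; rewrite !L2adj_comp !L2adj_amull L2adj_si.
rewrite -!comp_lfunA optraceC -!comp_lfunA starK.
by rewrite [(amull _ \o (si \o _))%VF]comp_lfunA comp_amull_si -!comp_lfunA.
Qed.

Lemma right_selfadjoint X Y :
  optrace (adj (schur Psi X A \o s) \o Y)%VF =
  optrace (adj (X \o s) \o schur Psi Y A)%VF.
Proof.
have [f A_ef] := ketbra_sum_exists A.
rewrite (schur_ketbrar X A_ef) (schur_ketbrar Y (ketbra_sum_real A_ef)).
rewrite comp_lfun_suml L2adj_sum comp_lfun_suml comp_lfun_sumr !optrace_sum.
apply: eq_bigr => k _; rewrite !L2adj_comp !L2adj_amulr L2adj_s.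
rewrite s_star siK !starK -!comp_lfunA [(s \o (amulr _ \o _))%VF]comp_lfunA.
by rewrite comp_amulr_s -!comp_lfunA optraceC -!comp_lfunA.
Qed.

End RealMap.

(** s is invertible, so the first factor under the trace is arbitrary. *)
Lemma left_nondegenerate Y :
  (forall X, optrace (adj (si \o X) \o Y)%VF = 0) -> Y = 0.
Proof.
move=> Y0; apply: optrace_eq0 => Z; rewrite -[Z]L2adjK.
rewrite -(Y0 (s \o adj Z)%VF); congr (optrace (adj _ \o _)%VF).
by apply/lfunP => x; rewrite !comp_lfunE /= sK.
Qed.

Lemma right_nondegenerate Y :
  (forall X, optrace (adj (X \o s) \o Y)%VF = 0) -> Y = 0.
Proof.
move=> Y0; apply: optrace_eq0 => Z; rewrite -[Z]L2adjK.
rewrite -(Y0 (adj Z \o si)%VF); congr (optrace (adj _ \o _)%VF).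
by apply/lfunP => x; rewrite !comp_lfunE /= sK.
Qed.

End L2Space.

(** * Self-adjointness of the two Schur maps *)

(** [adjoint] picks some adjoint; nondegeneracy of the form leaves f as the only
    candidate. *)
Lemma adjoint_selfadjoint (R : realType) (V : vectType R[i])
    (ip : V -> V -> R[i]) (f : 'End(V)) :
  (forall v w w', ip v (w - w') = ip v w - ip v w') ->
  (forall w, (forall v, ip v w = 0) -> w = 0) ->
  (forall v w, ip (f v) w = ip v (f w)) -> adjoint ip ip f = f.
Proof.
move=> ipB ip0 fsa; rewrite /adjoint; case: xgetP => [g _ gP|/(_ f)] //.
apply/lfunP => w; apply/eqP; rewrite -subr_eq0; apply/eqP/ip0 => v.
by rewrite ipB -fsa -gP subrr.
Qed.

Theorem theorem6p6 (R : realType) (M : cstarAlgType R) (Psi : {scalar M})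
    (delta : R) (A : 'End(M)) (tr : {scalar M}) (rho : M)
    (graph : quantum_graph Psi delta A)
    (tr_faithful : faithful_positive tr) (tr_tracial : tracial tr)
    (rho_pos : cpositive rho) (rho_unit : rho \is a GRing.unit)
    (Psi_rho : forall a : M, Psi a = tr (rho * a)) :
  adjoint (left_ip Psi rho) (left_ip Psi rho) (left_schur Psi delta A) =
    left_schur Psi delta A /\
  adjoint (right_ip Psi rho) (right_ip Psi rho) (right_schur Psi delta A) =
    right_schur Psi delta A.
Proof.
have [system _ A_real A_adj_real] := graph.
have PsiP := qs_state system.
set s := modular rho (- 'i%C); set si := modular rho 'i%C.
have sE x : s x = rho * x * rho^-1 by exact: modular_NiE PsiP _ _ _.
have siE x : si x = rho^-1 * x * rho by exact: modular_iE PsiP _ _ _.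
have s_kms a b : Psi (a * b) = Psi (b * s a).
  rewrite !Psi_rho sE mulrA [LHS]tr_tracial !mulrA [RHS]tr_tracial.
  by rewrite -!mulrA mulKr.
have sK : cancel s si by move=> x; rewrite siE sE -!mulrA mulVr // mulr1 mulKr.
have siK : cancel si s by move=> x; rewrite siE sE -!mulrA mulrV // mulr1 mulVKr.
have sM : {morph s : a b / a * b}.
  by move=> a b; rewrite !sE -!mulrA mulKr.
have s_star a : star (s a) = si (star a).
  have rhoS := cpositive_star rho_pos.
  by rewrite sE siE !starM star_inv // rhoS mulrA.
have ipB (h k l : 'End(M)) : optrace (h \o (k - l))%VF =
    optrace (h \o k)%VF - optrace (h \o l)%VF.
  rewrite -scaleN1r comp_lfunDr -comp_lfunZr.
  by rewrite optraceD optraceZ mulN1r.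
have c_real : conjc ((delta ^- 2)%:C : R[i]) = (delta ^- 2)%:C by exact: conjc_real.
split; apply: adjoint_selfadjoint => [X Y Z|Y|X Y]; first exact: ipB.
- move=> Y0; apply: (left_nondegenerate PsiP sK) => X; exact: Y0.
- rewrite !left_schurE /left_ip -/si -!comp_lfunZr L2adjZ // c_real.
  by rewrite -comp_lfunZl !optraceZ (left_selfadjoint PsiP system s_kms sK siK).
- exact: ipB.
- move=> Y0; apply: (right_nondegenerate PsiP sK) => X; exact: Y0.
- rewrite !right_schurE /right_ip -/s -comp_lfunZr -comp_lfunZl L2adjZ // c_real.
  by rewrite -comp_lfunZl !optraceZ (right_selfadjoint PsiP system s_kms siK).
Qed.
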